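(* Let $\mathcal X$ be a zero-nonzero pattern and let $k=\operatorname{tri}(\mathcal X)$. If $\operatorname{mr}\mathcal R(\mathcal X)>k$, then every matroid $M\in\mathcal R(\mathcal X^T)$ of rank $k$ fails to have an adjoint.
   Context: A zero-nonzero pattern is a matrix with entries in $\{0,*\}$; the zero set of a row is the set of column labels where it has entry $0$. For a pattern $\mathcal Y$, $\mathcal R(\mathcal Y)$ is the set of matroids on the set of column labels of $\mathcal Y$ such that the zero set of each row is a flat; $\operatorname{mr}\mathcal R(\mathcal Y)$ is the smallest rank of a matroid in it. A square pattern is a triangle if its rows and columns can be permuted (independently) to give a lower triangular pattern with all diagonal entries $*$. The triangle number $\operatorname{tri}(\mathcal X)$ is the largest $k$ such that some $k\times k$ submatrix of $\mathcal X$ is a triangle. A simple matroid $M'$ is an adjoint of $M$ if $r(M')=r(M)$ and there is a map $\phi$ from the lattice of flats of $M$ to that of $M'$ which is injective, inclusion-reversing, and restricts to a bijection from the hyperplanes of $M$ onto the rank-$1$ flats of $M'$. *)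

(* Defs.v *)
From HB Require Import structures.
From mathcomp Require Import all_boot all_order all_fingroup all_algebra.

Set Implicit Arguments.
Unset Strict Implicit.
Unset Printing Implicit Defensive.

Section MatroidDef.
Variable T : finType.
Implicit Types (I : {set {set T}}) (A B : {set T}).

Definition matroid_axioms I : bool :=
  [&& set0 \in I,
      [forall B in I, forall A : {set T}, (A \subset B) ==> (A \in I)] &
      [forall A in I, forall B in I,
         (#|A| < #|B|) ==> [exists x in B :\: A, x |: A \in I]]].

Record matroid := Matroid {
  indeps : {set {set T}};
  indepsP : matroid_axioms indeps
}.

HB.instance Definition _ := [isSub for indeps].
HB.instance Definition _ := [Finite of matroid by <:].

Lemma free_matroid_axioms : matroid_axioms [set: {set T}].
Proof.
apply/and3P; split; first by rewrite inE.
  by apply/forall_inP => B _; apply/forallP => A; rewrite inE implybT.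
apply/forall_inP => A _; apply/forall_inP => B _; apply/implyP => ltAB.
have /card_gt0P[x xBA] : 0 < #|B :\: A|.
  rewrite cardsD subn_gt0; apply: leq_ltn_trans ltAB.
  by rewrite subset_leq_card // subsetIr.
by apply/exists_inP; exists x => //; rewrite inE.
Qed.

Definition free_matroid : matroid := Matroid free_matroid_axioms.

End MatroidDef.

Section MatroidTheory.
Variables (T : finType) (M : matroid T).
Implicit Types (A F H : {set T}).

Definition rank A : nat := \max_(B in indeps M | B \subset A) #|B|.

Definition mrank : nat := rank [set: T].

Definition flat F : bool := [forall x, (x \notin F) ==> (rank F < rank (x |: F))].

Definition flats : {set {set T}} := [set F | flat F].

Definition hyperplanes : {set {set T}} :=
  [set H in flats | (rank H).+1 == mrank].

Definition rank1_flats : {set {set T}} := [set F in flats | rank F == 1].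

(* No loops and no pairs of parallel elements. *)
Definition simple : bool := [forall x, forall y, [set x; y] \in indeps M].

End MatroidTheory.

(* [phi] is total, but only its values on the flats of [M] matter.  The last
   clause, with injectivity on all flats, says that [phi] restricts to a
   bijection from the hyperplanes of [M] onto the rank-1 flats of [M']. *)
Definition adjoint (T T' : finType) (M : matroid T) (M' : matroid T') : Prop :=
  [/\ simple M', mrank M' = mrank M &
      exists phi : {set T} -> {set T'},
        [/\ {in flats M, forall F, phi F \in flats M'},
            {in flats M &, injective phi},
            {in flats M &, forall F G : {set T},
               F \subset G -> phi G \subset phi F} &
            phi @: hyperplanes M = rank1_flats M']].

Definition has_adjoint (T : finType) (M : matroid T) : Prop :=
  exists (T' : finType) (M' : matroid T'), adjoint M M'.

(* Entry [true] stands for [*] and [false] for [0]; the column labels of an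
   [m x n] pattern are the elements of ['I_n]. *)
Definition pattern (m n : nat) := 'M[bool]_(m, n).

Definition zero_set (m n : nat) (Y : pattern m n) (i : 'I_m) : {set 'I_n} :=
  [set j | ~~ Y i j].

Definition matroids_of (m n : nat) (Y : pattern m n) : {set matroid 'I_n} :=
  [set M | [forall i, zero_set Y i \in flats M]].

Lemma rank_free (T : finType) (A : {set T}) : rank (free_matroid T) A = #|A|.
Proof.
apply/eqP; rewrite eqn_leq; apply/andP; split.
  by apply/bigmax_leqP => B /andP[_ /subset_leq_card].
by apply: (bigmax_sup A) => //; rewrite inE subxx.
Qed.

Lemma free_matroid_in (m n : nat) (Y : pattern m n) :
  free_matroid 'I_n \in matroids_of Y.
Proof.
rewrite inE; apply/forallP => i; rewrite inE; apply/forallP => x.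
by apply/implyP => xF; rewrite !rank_free cardsU1 xF.
Qed.

(* The default value of the [arg min] is never used, since the free matroid
   belongs to [matroids_of Y]. *)
Definition mr (m n : nat) (Y : pattern m n) : nat :=
  mrank [arg min_(M < free_matroid 'I_n in matroids_of Y) mrank M].

Lemma mr_min (m n : nat) (Y : pattern m n) :
  (exists2 M, M \in matroids_of Y & mrank M = mr Y) /\
  {in matroids_of Y, forall M, mr Y <= mrank M}.
Proof.
rewrite /mr; case: arg_minnP => [|M MY minM]; first exact: free_matroid_in.
by split; first by exists M.
Qed.

Definition lower_triangular_star (k : nat) (B : pattern k k) : bool :=
  [forall i, B i i] &&
  [forall i : 'I_k, forall j : 'I_k, (i < j) ==> ~~ B i j].

Definition triangle (k : nat) (B : pattern k k) : bool :=
  [exists s : 'S_k, exists t : 'S_k,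
     lower_triangular_star (row_perm s (col_perm t B))].

Definition increasing (k n : nat) (f : {ffun 'I_k -> 'I_n}) : bool :=
  [forall i : 'I_k, forall j : 'I_k, (i < j) ==> (f i < f j)].

Definition has_triangle (m n : nat) (X : pattern m n) (k : nat) : bool :=
  [exists f : {ffun 'I_k -> 'I_m}, exists g : {ffun 'I_k -> 'I_n},
     [&& increasing f, increasing g & triangle (mxsub f g X)]].

Definition tri (m n : nat) (X : pattern m n) : nat :=
  \max_(k < (minn m n).+1 | has_triangle X k) k.

(* Main.v *)
Require Import Defs.
From mathcomp Require Import all_boot all_order all_fingroup all_algebra.
From mathcomp Require Import zify.

Set Implicit Arguments.
Unset Strict Implicit.
Unset Printing Implicit Defensive.

(** Let [M'] be an adjoint of [M] through [phi].  Along chains of flats the ranks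
    force [phi] to turn rank into corank; as [phi] is injective, it must then turn
    joins of flats into intersections, and so it reverses inclusion in both
    directions.  Place every column [j] of the pattern freely on the flat
    [phi (Z j)] of [M'], where [Z j] is the zero set of the column: the matroid
    obtained has rank at most [r(M)], and the zero set of row [i], that is
    [{j | i \in Z j}], consists of the columns placed inside the flat
    [phi (closure {i})], so it is a flat.  Hence an adjoint of [M] would make the
    minimum rank for [X] at most [r(M)].

    "Placed freely" is realised as the Edmonds matroid of the submodular function
    sending a set [A] of columns to the rank of the union of the flats
    [phi (Z j)], [j] in [A]. *)

Lemma set_ind (T : finType) (P : {set T} -> Prop) :
  P set0 -> (forall x (A : {set T}), x \notin A -> P A -> P (x |: A)) ->
  forall A, P A.
Proof.
move=> P0 PU A; have [n le_n] := ubnP #|A|; elim: n => // n IHn in A le_n *.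
have [->//|[x xA]] := set_0Vmem A; rewrite -(setD1K xA); apply: PU.
  by rewrite !inE eqxx.
by apply: IHn; move: le_n; rewrite (cardsD1 x) xA.
Qed.

Section SubmodularFunctions.
Variable T : finType.
Implicit Types (f : {set T} -> nat) (A B C : {set T}).

Definition monotone f : Prop := forall A B, A \subset B -> f A <= f B.

Definition submodular f : Prop :=
  forall A B, f (A :|: B) + f (A :&: B) <= f A + f B.

Lemma submodular_marginal f A B C : monotone f -> submodular f -> A \subset B ->
  f (C :|: B) + f A <= f (C :|: A) + f B.
Proof.
move=> f_mono f_submod AB; have := f_submod (C :|: A) B.
rewrite -setUA (setUidPr AB); apply: leq_trans; rewrite leq_add2l f_mono //.
by rewrite subsetI subsetUr.
Qed.

Lemma submodular_absorb f A B : monotone f -> submodular f ->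
  {in B, forall x, f (x |: A) = f A} -> f (B :|: A) = f A.
Proof.
move=> f_mono f_submod; elim/set_ind: B => [|x B _ IHB] absorb.
  by rewrite set0U.
have {}IHB : f (B :|: A) = f A by apply: IHB => y yB; rewrite absorb // setU1r.
have := submodular_marginal [set x] f_mono f_submod (subsetUr B A).
rewrite absorb ?setU11 // IHB setUA.
by have := f_mono _ _ (subsetUr (x |: B) A); lia.
Qed.

End SubmodularFunctions.

Section MatroidRank.
Variables (T : finType) (M : matroid T).
Implicit Types (A B F G I : {set T}).

Lemma indep0 : set0 \in indeps M.
Proof. by case/and3P: (indepsP M). Qed.

Lemma indepS A B : A \subset B -> B \in indeps M -> A \in indeps M.
Proof.
case/and3P: (indepsP M) => _ /forall_inP sub _ AB BM.
by have /forallP/(_ A)/implyP := sub B BM; apply.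
Qed.

Lemma indep_augment A B : A \in indeps M -> B \in indeps M -> #|A| < #|B| ->
  exists2 x, x \in B :\: A & x |: A \in indeps M.
Proof.
case/and3P: (indepsP M) => _ _ /forall_inP aug AM BM ltAB.
have /forall_inP/(_ B BM)/implyP/(_ ltAB)/exists_inP[x xBA xA] := aug A AM.
by exists x.
Qed.

Lemma indep_leq_rank I A : I \in indeps M -> I \subset A -> #|I| <= rank M A.
Proof. by move=> IM IA; apply: (bigmax_sup I); rewrite ?IM. Qed.

Lemma indep_extend I A : I \in indeps M -> I \subset A ->
  exists2 B, B \in indeps M & [/\ I \subset B, B \subset A & #|B| = rank M A].
Proof.
move=> IM IA; pose indep_in B := (B \in indeps M) && (B \subset A).
have /maxset_exists[B /maxsetP[/andP[BM BA] maxB] IB] : indep_in I by apply/andP.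
exists B => //; split=> //; apply/eqP; rewrite eqn_leq indep_leq_rank //=.
apply/bigmax_leqP => C /andP[CM CA]; rewrite leqNgt; apply/negP => ltBC.
have [x /setDP[xC xB] xBM] := indep_augment BM CM ltBC.
have xBA : indep_in (x |: B).
  by rewrite /indep_in xBM subUset sub1set (subsetP CA).
by rewrite -(maxB _ xBA (subsetU1 x B)) setU11 in xB.
Qed.

Lemma rank_basis A : exists2 B, B \in indeps M & B \subset A /\ #|B| = rank M A.
Proof.
have [B BM [_ BA cardB]] := indep_extend indep0 (sub0set A).
by exists B.
Qed.

Lemma rank0 : rank M set0 = 0.
Proof.
have [I _ [+ <-]] := rank_basis set0.
by rewrite subset0 => /eqP->; rewrite cards0.
Qed.

Lemma rank_monotone : monotone (rank M).
Proof.
move=> A B AB; have [I IM [IA <-]] := rank_basis A.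
exact: indep_leq_rank (subset_trans IA AB).
Qed.

Lemma rank_submodular : submodular (rank M).
Proof.
move=> A B; have [I IM [IAB <-]] := rank_basis (A :&: B).
have [|K KM [IK KAB <-]] := @indep_extend I (A :|: B) IM.
  by apply: subset_trans IAB _; rewrite subIset // subsetUl.
have leK C : #|K :&: C| <= rank M C.
  by apply: indep_leq_rank (subsetIr _ _); apply: indepS KM; apply: subsetIl.
have leI : #|I| <= #|K :&: A :&: (K :&: B)|.
  by rewrite -setIIr subset_leq_card // subsetI IK.
have := cardsUI (K :&: A) (K :&: B); rewrite -setIUr (setIidPl KAB).
by have := leK A; have := leK B; lia.
Qed.

Lemma rankU1_leq x A : rank M (x |: A) <= (rank M A).+1.
Proof.
have := rank_submodular [set x] A.
have [I _ [/subset_leq_card]] := rank_basis [set x]; rewrite cards1; lia.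
Qed.

Lemma flat_rank_lt F A x : flat M F -> A \subset F -> x \notin F ->
  rank M A < rank M (x |: A).
Proof.
move=> /forallP/(_ x)/implyP flatF AF /flatF.
by have := submodular_marginal [set x] rank_monotone rank_submodular AF; lia.
Qed.

Lemma flat_proper_rank F A : flat M F -> F \proper A -> rank M F < rank M A.
Proof.
move=> flatF /properP[FA [x xA xF]].
apply: leq_trans (flat_rank_lt flatF (subxx F) xF) _.
by apply: rank_monotone; rewrite subUset sub1set xA.
Qed.

Lemma rank_leq_sub_flat F G A : flat M G -> A \subset F -> A \subset G ->
  rank M F <= rank M A -> F \subset G.
Proof.
move=> flatG AF AG; apply: contraTT => /subsetPn[x xF xG]; rewrite -ltnNge.
apply: leq_trans (flat_rank_lt flatG AG xG) _.
by apply: rank_monotone; rewrite subUset sub1set xF.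
Qed.

Definition mclosure A : {set T} := [set x | rank M (x |: A) == rank M A].

Lemma sub_mclosure A : A \subset mclosure A.
Proof. by apply/subsetP => x xA; rewrite inE (setUidPr _) ?sub1set. Qed.

Lemma rank_mclosure A : rank M (mclosure A) = rank M A.
Proof.
rewrite -{1}(setUidPl (sub_mclosure A)).
apply: submodular_absorb rank_monotone rank_submodular _ => x.
by rewrite inE => /eqP.
Qed.

Lemma flat_mclosure A : flat M (mclosure A).
Proof.
apply/forallP => x; apply/implyP; rewrite inE rank_mclosure => rank_neq.
have := rank_monotone (setUS [set x] (sub_mclosure A)).
by have := rank_monotone (subsetU1 x A); lia.
Qed.

Lemma mclosure_subset A F : flat M F -> (mclosure A \subset F) = (A \subset F).
Proof.
move=> flatF; apply/idP/idP => [|AF]; first exact/subset_trans/sub_mclosure.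
by apply: rank_leq_sub_flat flatF (sub_mclosure A) AF _; rewrite rank_mclosure.
Qed.

Lemma mclosureS A B : A \subset B -> mclosure A \subset mclosure B.
Proof.
rewrite mclosure_subset ?flat_mclosure // => AB.
exact: subset_trans AB (sub_mclosure B).
Qed.

Lemma mclosure_flat F : flat M F -> mclosure F = F.
Proof.
move=> flatF; apply/eqP.
by rewrite eqEsubset mclosure_subset // subxx sub_mclosure.
Qed.

End MatroidRank.

Section FlatReversingInjection.
Variables (T T' : finType) (M : matroid T) (M' : matroid T').
Variable phi : {set T} -> {set T'}.
Hypothesis mrank_leq : mrank M' <= mrank M.
Hypothesis phi_flat : {in flats M, forall F, phi F \in flats M'}.
Hypothesis phi_inj : {in flats M &, injective phi}.
Hypothesis phi_rev : {in flats M &, forall F G : {set T},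
  F \subset G -> phi G \subset phi F}.
Implicit Types (A B C F G : {set T}).

Local Notation cl := (mclosure M).

Let cl_flats A : cl A \in flats M.
Proof. by rewrite inE flat_mclosure. Qed.

Lemma flat_phi_closure A : flat M' (phi (cl A)).
Proof. by have := phi_flat (cl_flats A); rewrite inE. Qed.

Lemma phi_closure_anti A B : A \subset B -> phi (cl B) \subset phi (cl A).
Proof. by move=> AB; rewrite phi_rev ?mclosureS. Qed.

Lemma phi_closure_inj A B : phi (cl A) = phi (cl B) -> cl A = cl B.
Proof. exact: phi_inj. Qed.

Lemma rank_phi_closureU1 x A :
  rank M' (phi (cl (x |: A))) + rank M (x |: A)
    <= rank M' (phi (cl A)) + rank M A.
Proof.
have [eq_phi|neq_phi] := eqVneq (phi (cl (x |: A))) (phi (cl A)).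
  by rewrite eq_phi -(rank_mclosure M (x |: A)) (phi_closure_inj eq_phi)
    rank_mclosure.
have /(flat_proper_rank (flat_phi_closure _)) :
    phi (cl (x |: A)) \proper phi (cl A).
  by rewrite properEneq neq_phi phi_closure_anti ?subsetU1.
by have := rankU1_leq M x A; lia.
Qed.

Lemma rank_phi_closureU A B :
  rank M' (phi (cl (B :|: A))) + rank M (B :|: A)
    <= rank M' (phi (cl A)) + rank M A.
Proof.
elim/set_ind: B => [|x B _ IHB]; first by rewrite set0U.
by rewrite -setUA; apply: leq_trans (rank_phi_closureU1 x _) IHB.
Qed.

Lemma rank_phi_closure A : rank M' (phi (cl A)) + rank M A = mrank M.
Proof.
apply/eqP; rewrite eqn_leq; apply/andP; split.
  have := rank_phi_closureU set0 A; rewrite setU0 rank0 addn0 => le_phi0.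
  apply: leq_trans le_phi0 (leq_trans _ mrank_leq).
  exact/rank_monotone/subsetT.
by have := rank_phi_closureU A [set: T]; rewrite setTU; apply/leq_trans/leq_addl.
Qed.

(* A point [z] of the left-hand side outside the flat [D] on the right would
   span with [D] both flats on the left, whose ranks exceed that of [D] by at
   most one; they would then coincide, against injectivity. *)
Lemma phi_closureU1U1 x y A :
  phi (cl (x |: A)) :&: phi (cl (y |: A)) = phi (cl (x |: (y |: A))).
Proof.
set B := x |: (y |: A); set D := phi (cl B).
have [xAB yAB] : x |: A \subset B /\ y |: A \subset B.
  by rewrite setUS ?subsetU1.
apply/eqP; rewrite eqEsubset subsetI !phi_closure_anti // !andbT.
apply/subsetP => z /setIP[zx zy]; apply/idPn => zD.
have rankD : rank M' D + rank M B = mrank M := rank_phi_closure B.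
have ltD : rank M' D < rank M' (z |: D).
  exact: flat_rank_lt (flat_phi_closure _) (subxx D) zD.
have zD_spans C : C \subset B -> rank M B <= (rank M C).+1 -> z \in phi (cl C) ->
    z |: D \subset phi (cl C) /\ rank M' (phi (cl C)) <= rank M' (z |: D).
  move=> CB leB zC; rewrite subUset sub1set zC phi_closure_anti //; split=> //.
  by have := rank_phi_closure C; lia.
have [zDx spanx] : z |: D \subset phi (cl (x |: A)) /\
    rank M' (phi (cl (x |: A))) <= rank M' (z |: D).
  by apply: zD_spans; rewrite // /B setUCA rankU1_leq.
have [zDy spany] : z |: D \subset phi (cl (y |: A)) /\
    rank M' (phi (cl (y |: A))) <= rank M' (z |: D).
  by apply: zD_spans; rewrite // rankU1_leq.
have /phi_closure_inj eq_cl : phi (cl (x |: A)) = phi (cl (y |: A)).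
  apply/eqP; rewrite eqEsubset.
  rewrite (rank_leq_sub_flat (flat_phi_closure _) zDx zDy spanx).
  by rewrite (rank_leq_sub_flat (flat_phi_closure _) zDy zDx spany).
have clB : cl B \subset cl (y |: A).
  rewrite mclosure_subset ?flat_mclosure // subUset sub_mclosure andbT.
  by rewrite sub1set -eq_cl (subsetP (sub_mclosure M _)) ?setU11.
by rewrite (subsetP (phi_rev _ _ clB)) in zD.
Qed.

Lemma phi_closureU1 x A : phi (cl (x |: A)) = phi (cl [set x]) :&: phi (cl A).
Proof.
elim/set_ind: A => [|y A _ IHA].
  by rewrite setU0; apply/esym/setIidPl/phi_closure_anti/sub0set.
rewrite -phi_closureU1U1 IHA -setIA; congr (_ :&: _).
by apply/setIidPr/phi_closure_anti/subsetU1.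
Qed.

Lemma phi_closureU A B : phi (cl (A :|: B)) = phi (cl A) :&: phi (cl B).
Proof.
elim/set_ind: A => [|x A _ IHA].
  by rewrite set0U; apply/esym/setIidPr/phi_closure_anti/sub0set.
by rewrite -setUA !(phi_closureU1 x) IHA setIA.
Qed.

Lemma phi_subset F G : flat M F -> flat M G ->
  (phi F \subset phi G) = (G \subset F).
Proof.
move=> flatF flatG; apply/idP/idP => [FG|]; last by apply: phi_rev; rewrite inE.
have /phi_closure_inj eq_cl : phi (cl (F :|: G)) = phi (cl F).
  by rewrite phi_closureU !mclosure_flat //; apply/setIidPl.
rewrite -(mclosure_flat flatF) -eq_cl.
exact: subset_trans (subsetUr F G) (sub_mclosure M _).
Qed.

End FlatReversingInjection.

Section EdmondsMatroid.
Variables (T : finType) (f : {set T} -> nat).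
Hypothesis f_mono : monotone f.
Hypothesis f_submod : submodular f.
Implicit Types (A B I J K S : {set T}).

Definition edmonds_indeps : {set {set T}} :=
  [set I : {set T} | [forall J : {set T}, (J \subset I) ==> (#|J| <= f J)]].

Lemma edmonds_indepP I :
  reflect (forall J, J \subset I -> #|J| <= f J) (I \in edmonds_indeps).
Proof.
by rewrite inE; apply: (iffP forallP) => indI J; apply/implyP/indI.
Qed.

Definition tight J : bool := #|J| == f J.

Lemma tightU I J K : I \in edmonds_indeps -> J \subset I -> K \subset I ->
  tight J -> tight K -> tight (J :|: K).
Proof.
move=> /edmonds_indepP indI JI KI /eqP tightJ /eqP tightK.
have := indI (J :&: K) (subset_trans (subsetIl J K) JI).
have := indI (J :|: K); rewrite subUset JI KI => /(_ isT).
by rewrite /tight; have := f_submod J K; have := cardsUI J K; lia.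
Qed.

Lemma edmonds_dep_tight I x :
  I \in edmonds_indeps -> x |: I \notin edmonds_indeps ->
  exists2 J : {set T}, J \subset I & tight J /\ f (x |: J) = f J.
Proof.
move=> /edmonds_indepP indI; rewrite inE negb_forall => /existsP[J].
rewrite negb_imply -ltnNge => /andP[JxI ltJ].
have JI : J :\ x \subset I by rewrite subDset.
have xJ : x \in J.
  apply: contraTT ltJ => xJ; rewrite -leqNgt indI //.
  by apply: subset_trans JI; rewrite subsetD1 subxx.
exists (J :\ x) => //; rewrite /tight setD1K //.
have := indI _ JI; have := f_mono (subsetDl J [set x]).
by move: ltJ; rewrite (cardsD1 x) xJ; lia.
Qed.

(* The largest tight subset [J] of [A] exists because tight sets are closed under
   unions, and all of [B :\: A] is absorbed by it. *)
Lemma edmonds_maximal_leq_card A B :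
  A \in edmonds_indeps -> B \in edmonds_indeps ->
  {in B :\: A, forall x, x |: A \notin edmonds_indeps} -> #|B| <= #|A|.
Proof.
move=> indA indB depA.
have [/eqP|[x0 /depA dep0]] := set_0Vmem (B :\: A).
  by rewrite setD_eq0 => /subset_leq_card.
pose tight_in J := (J \subset A) && tight J.
have [|J /maxsetP[/andP[JA tightJ] maxJ]] := ex_maxset (P := tight_in).
  by have [J JA [tightJ _]] := edmonds_dep_tight indA dep0; exists J; apply/andP.
have tight_sub K : K \subset A -> tight K -> K \subset J.
  move=> KA tightK; apply/setUidPl/maxJ; last exact: subsetUl.
  by rewrite /tight_in subUset JA KA (tightU indA).
have absorbed : f ((B :\: A) :|: J) = f J.
  apply: submodular_absorb => // x /depA depx.
  have [K KA [tightK fK]] := edmonds_dep_tight indA depx.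
  have := submodular_marginal [set x] f_mono f_submod (tight_sub K KA tightK).
  by have := f_mono (subsetU1 x J); lia.
have leJ : #|B :\: (A :\: J)| <= #|J|.
  rewrite (eqP tightJ) -absorbed setDDr.
  apply: leq_trans (edmonds_indepP _ indB _ _) (f_mono _).
    by rewrite subUset subsetDl subsetIl.
  by rewrite setUS ?subsetIr.
have := cardsID (A :\: J) B; have := cardsID J A; rewrite (setIidPr JA).
by have := subset_leq_card (subsetIr B (A :\: J)); lia.
Qed.

Lemma edmonds_matroid_axioms : matroid_axioms edmonds_indeps.
Proof.
apply/and3P; split.
- by apply/edmonds_indepP => J; rewrite subset0 => /eqP->; rewrite cards0.
- apply/forall_inP => B /edmonds_indepP indB.
  apply/forallP => A; apply/implyP => AB.
  by apply/edmonds_indepP => J JA; apply/indB/(subset_trans JA).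
- apply/forall_inP => A indA; apply/forall_inP => B indB; apply/implyP.
  apply: contraLR; rewrite negb_exists_in -leqNgt => /forall_inP.
  exact: edmonds_maximal_leq_card.
Qed.

Definition edmonds_matroid : matroid T := Matroid edmonds_matroid_axioms.

Lemma edmonds_mrank_leq : mrank edmonds_matroid <= f [set: T].
Proof.
apply/bigmax_leqP => I /andP[/edmonds_indepP indI _].
exact: leq_trans (indI _ (subxx I)) (f_mono (subsetT I)).
Qed.

Lemma edmonds_flat S :
  (forall x, x \notin S -> f S < f (x |: S)) -> flat edmonds_matroid S.
Proof.
move=> f_lt; apply/forallP => x; apply/implyP => xS.
have [I indI [IS <-]] := rank_basis edmonds_matroid S.
have xI : x \notin I by apply: contraNN xS; apply: (subsetP IS).
suff /indep_leq_rank/(_ (setUS [set x] IS)) : x |: I \in indeps edmonds_matroid.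
  by rewrite cardsU1 xI.
apply/idPn => /(edmonds_dep_tight indI)[J JI [_ fJ]].
have := submodular_marginal [set x] f_mono f_submod (subset_trans JI IS).
by have := f_lt x xS; lia.
Qed.

End EdmondsMatroid.

Section FreePlacement.
Variables (T T' : finType) (M : matroid T') (P : T -> {set T'}).
Implicit Types (A B : {set T}) (F : {set T'}).

Definition span_rank A : nat := rank M (\bigcup_(j in A) P j).

Lemma span_rank_monotone : monotone span_rank.
Proof.
move=> A B AB; apply/rank_monotone/bigcupsP => j jA.
by apply: (bigcup_sup j); rewrite ?(subsetP AB).
Qed.

Lemma span_rank_submodular : submodular span_rank.
Proof.
move=> A B; apply: leq_trans (rank_submodular _ _ _).
rewrite -bigcup_setU leq_add2l.
apply/rank_monotone/bigcupsP => j /setIP[jA jB].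
by rewrite subsetI !(bigcup_sup j).
Qed.

Definition free_placement : matroid T :=
  edmonds_matroid span_rank_monotone span_rank_submodular.

Lemma free_placement_mrank_leq : mrank free_placement <= mrank M.
Proof.
by apply: leq_trans (edmonds_mrank_leq _ _) _; apply/rank_monotone/subsetT.
Qed.

Lemma free_placement_flat F :
  flat M F -> flat free_placement [set j | P j \subset F].
Proof.
move=> flatF; apply: edmonds_flat => x; rewrite inE => /subsetPn[y yP yF].
set S := [set j | P j \subset F].
have SF : \bigcup_(j in S) P j \subset F by apply/bigcupsP => j; rewrite inE.
apply: leq_trans (flat_rank_lt flatF SF yF) _.
by apply: rank_monotone; rewrite bigcup_setU big_set1 setSU // sub1set.
Qed.

End FreePlacement.

Lemma zero_set_tr (m n : nat) (X : pattern m n) (i : 'I_m) (j : 'I_n) :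
  (i \in zero_set X^T%R j) = (j \in zero_set X i).
Proof. by rewrite !inE mxE. Qed.

Lemma has_adjoint_mr_leq (m n : nat) (X : pattern m n) (M : matroid 'I_m) :
  M \in matroids_of X^T%R -> has_adjoint M -> mr X <= mrank M.
Proof.
rewrite inE => /forallP zero_flats.
move=> [T' [M' [_ eq_mrank [phi [phi_flat phi_inj phi_rev _]]]]].
have mrank_leq : mrank M' <= mrank M by rewrite eq_mrank.
pose N := free_placement M' (fun j => phi (zero_set X^T%R j)).
suff NX : N \in matroids_of X.
  apply: leq_trans ((mr_min X).2 N NX) _.
  exact: leq_trans (free_placement_mrank_leq _ _) mrank_leq.
rewrite inE; apply/forallP => i; rewrite inE.
have -> : zero_set X i =
    [set j | phi (zero_set X^T%R j) \subset phi (mclosure M [set i])].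
  apply/setP => j; have := zero_flats j; rewrite !in_set => flatZ.
  rewrite (phi_subset mrank_leq phi_flat phi_inj phi_rev) ?flat_mclosure //.
  by rewrite mclosure_subset // sub1set zero_set_tr inE.
exact/free_placement_flat/(flat_phi_closure phi_flat).
Qed.

Theorem theorem4p10 (m n : nat) (X : pattern m n) :
  tri X < mr X ->
  forall M : matroid 'I_m,
    M \in matroids_of (X^T)%R -> mrank M = tri X -> ~ has_adjoint M.
Proof.
move=> lt_tri M MX eq_tri /(has_adjoint_mr_leq MX).
by rewrite eq_tri leqNgt lt_tri.
Qed.
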